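(* Let $M\in\mathbb{R}^{d\times d}$ be symmetric positive definite, let $S\in\mathbb{R}^{d\times d}$ be constant with $S^\top=-S$ or $S\preceq0$, and let $V:\mathbb{R}^d\to\mathbb{R}$ be differentiable. Let $\eta(t)$ be a scalar function and let $\tilde z(t)=[z(t)^\top,V(z(t))]^\top$ be a solution of the Lagrange-multiplier extended system $$\dot{\tilde z}=\tilde S(z)\,\nabla H(\tilde z),\qquad \tilde S(z)=\begin{bmatrix} S & \eta(t)S\nabla V(z)\\ \eta(t)\nabla V(z)^\top S & \eta(t)^2\,\nabla V(z)^\top S\nabla V(z)\end{bmatrix},$$ where $H(\tilde z)=\tfrac12 z^\top Mz+V$ for $\tilde z=[z^\top,V]^\top$. Then $$\frac{d}{dt}H(\tilde z(t))=0\ \text{ if } S^\top=-S,\qquad \frac{d}{dt}H(\tilde z(t))\le0\ \text{ if } S\preceq0 .$$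
   Context: $S\preceq0$ means that $\operatorname{sym}(S)=\tfrac12(S+S^\top)$ is negative semidefinite ($S$ need not be symmetric). In the extended system the last component $V$ of $\tilde z$ is treated as an independent coordinate when taking the gradient, so $\nabla H(\tilde z)=[(Mz)^\top,1]^\top$. Equivalently, the system reads $\dot z=SMz+\eta(t)S\nabla V(z)$, $\frac{d}{dt}V(z)=\eta(t)\nabla V(z)^\top\dot z$. It is a reformulation of $\dot z=S\nabla H(z)$ with $H(z)=\tfrac12z^\top Mz+V(z)$, in which $\eta$ is a Lagrange multiplier. *)

(* Defs.v *)
From HB Require Import structures.
From mathcomp Require Import all_boot all_order all_algebra.
From mathcomp Require Import all_classical all_reals all_analysis.
Set Implicit Arguments.
Unset Strict Implicit.
Unset Printing Implicit Defensive.
Import Order.TTheory GRing.Theory Num.Theory.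
Import numFieldNormedType.Exports.
Local Open Scope classical_set_scope.
Local Open Scope ring_scope.

Section Defs.
Context {R : realType}.

Definition quad_form {n : nat} (A : 'M[R]_n) (x : 'cV[R]_n) : R :=
  (x^T *m A *m x) 0 0.

Definition sym_posdef {n : nat} (A : 'M[R]_n) : Prop :=
  A^T = A /\ forall x : 'cV[R]_n, x != 0 -> 0 < quad_form A x.

Definition sym_negsemidef {n : nat} (A : 'M[R]_n) : Prop :=
  A^T = A /\ forall x : 'cV[R]_n, quad_form A x <= 0.

Definition sym_part {n : nat} (A : 'M[R]_n) : 'M[R]_n := 2^-1 *: (A + A^T).

(* The relation [S \preceq 0] for a matrix that need not be symmetric. *)
Definition preceq0 {n : nat} (S : 'M[R]_n) : Prop :=
  sym_negsemidef (sym_part S).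

Definition grad {n : nat} (f : 'cV[R]_n -> R) (x : 'cV[R]_n) : 'cV[R]_n :=
  \col_i 'D_(delta_mx i 0) f x.

Definition lift_state {d : nat} (V : 'cV[R]_d -> R) (z : 'cV[R]_d) :
  'cV[R]_(d + 1) := col_mx z (V z)%:M.

(* The last component is an independent coordinate of the argument, so [grad]
   of this function differentiates with respect to it as well. *)
Definition ext_energy {d : nat} (M : 'M[R]_d) (zt : 'cV[R]_(d + 1)) : R :=
  2^-1 * quad_form M (usubmx zt) + dsubmx zt 0 0.

(* [e] is the value of the Lagrange multiplier at the current time. *)
Definition ext_structure {d : nat} (S : 'M[R]_d) (V : 'cV[R]_d -> R)
    (e : R) (z : 'cV[R]_d) : 'M[R]_(d + 1) :=
  let g := grad V z in
  block_mx S                    (e *: (S *m g))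
           (e *: (g^T *m S))    (e ^+ 2 *: (g^T *m S *m g)).

(* [z] is defined on all of [R], but only its behaviour on the open time
   interval [I] is constrained; being a solution includes differentiability of
   the extended trajectory on [I]. *)
Definition ext_solution {d : nat} (M S : 'M[R]_d) (V : 'cV[R]_d -> R)
    (eta : R -> R) (I : set R) (z : R -> 'cV[R]_d) : Prop :=
  forall t, I t ->
    is_derive t (1 : R) (fun s => lift_state V (z s))
      (ext_structure S V (eta t) (z t)
        *m grad (ext_energy M) (lift_state V (z t))).

End Defs.

(* Main.v *)
Require Import Defs.
From mathcomp Require Import all_boot all_order all_algebra.
From mathcomp Require Import all_classical all_reals all_analysis.
Import Order.TTheory GRing.Theory Num.Theory.
Import numFieldNormedType.Exports.
Local Open Scope classical_set_scope.
Local Open Scope ring_scope.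

(** The extended structure matrix is a congruence of [S]: with
    [P = [1; eta g^T]], where [g] is the gradient of [V] at [z], it equals
    [P S P^T] ([ext_structure_congr]).  The extended energy [H] is a polynomial,
    hence differentiable, so along a differentiable curve with velocity [w] it
    changes at the rate [(grad H)^T w] ([is_derive_comp_grad]).  Along a
    solution [w = P S P^T grad H], so the rate is the quadratic form of [S] at
    [P^T grad H] ([ext_energy_rate]).  That form depends only on the symmetric
    part of [S] ([quad_form_sym_part]): it vanishes when [S] is skew-symmetric
    and is nonpositive when the symmetric part is negative semidefinite. *)

Section QuadraticForm.
Context {R : realType} {n : nat}.
Implicit Types (A : 'M[R]_n) (x : 'cV[R]_n).

Lemma quad_form_tr A x : quad_form A^T x = quad_form A x.
Proof.
have -> : quad_form A x = (x^T *m A *m x)^T 0 0 by rewrite [RHS]mxE.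
by rewrite !trmx_mul trmxK mulmxA.
Qed.

Lemma quad_form_sym_part A x : quad_form (sym_part A) x = quad_form A x.
Proof.
have -> : quad_form (sym_part A) x
    = 2^-1 * (quad_form A x + quad_form A^T x).
  by rewrite /quad_form /sym_part -scalemxAr -scalemxAl mulmxDr mulmxDl !mxE.
by rewrite quad_form_tr mulrDr [2^-1 * _]mulrC -splitr.
Qed.

Lemma quad_form_skew A x : A^T = - A -> quad_form A x = 0.
Proof.
move=> skewA; apply/eqP; rewrite -quad_form_sym_part /sym_part skewA subrr.
by rewrite scaler0 /quad_form mulmx0 mul0mx mxE.
Qed.

Lemma quad_form_preceq0 A x : preceq0 A -> quad_form A x <= 0.
Proof. by case=> _ /(_ x); rewrite quad_form_sym_part. Qed.

Lemma quad_formE A x :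
  quad_form A x = \sum_i (\sum_j x j 0 * A j i) * x i 0.
Proof.
rewrite /quad_form mxE; apply: eq_bigr => i _; congr (_ * _).
by rewrite mxE; apply: eq_bigr => j _; rewrite mxE.
Qed.

End QuadraticForm.

Section Gradient.
Context {R : realType} {n : nat}.
Implicit Types (f : 'cV[R]_n -> R) (c : R -> 'cV[R]_n) (x v w : 'cV[R]_n).

Lemma diff_grad f x v :
  differentiable f x -> 'd f x v = ((grad f x)^T *m v) 0 0.
Proof.
move=> dfx; rewrite mxE {1}(matrix_sum_delta v) linear_sum.
apply: eq_bigr => i _; rewrite big_ord1 linearZ /= !mxE deriveE //.
by rewrite mulrC.
Qed.

(** The chain rule along a curve, in terms of the gradient. *)
Lemma is_derive_comp_grad f c t w :
    is_derive t (1 : R) c w -> differentiable f (c t) ->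
  is_derive t (1 : R) (f \o c) (((grad f (c t))^T *m w) 0 0).
Proof.
move=> [/derivable1_diffP dct <-] dfc.
have dfct : differentiable (f \o c) t by apply: differentiable_comp.
split; first exact/derivable1_diffP.
by rewrite deriveE // diff_comp //= diff_grad // deriveE.
Qed.

End Gradient.

Section ExtendedSystem.
Context {R : realType} {d : nat}.
Implicit Types (M S : 'M[R]_d) (V : 'cV[R]_d -> R).

Lemma differentiable_ext_energy M (x : 'cV[R]_(d + 1)) :
  differentiable (ext_energy M) x.
Proof.
pose coord i : 'cV[R]_(d + 1) -> R := fun y => y i 0.
have dcoord i : differentiable (coord i) x by exact: differentiable_coord.
have -> : ext_energy M = 2^-1 *:
    (\sum_(i < d) (\sum_(j < d) M j i *: coord (lshift 1 j))
                   * coord (lshift 1 i)) + coord (rshift d 0).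
  (* [H] as a polynomial in the coordinates of the extended state. *)
  apply/funext => y; rewrite /ext_energy quad_formE !fctE mxE.
  congr (_ * _ + _); rewrite fct_sumE; apply: eq_bigr => i _.
  rewrite !fctE fct_sumE mxE; congr (_ * _); apply: eq_bigr => j _.
  by rewrite mxE mulrC.
apply: differentiableD => //; apply: differentiableZ.
apply: differentiable_sum => i; apply: differentiableM => //.
by apply: differentiable_sum => j; apply: differentiableZ.
Qed.

Lemma ext_structure_congr S V (e : R) (z : 'cV[R]_d) :
  let P := col_mx 1%:M (e *: (grad V z)^T) in
  ext_structure S V e z = P *m S *m P^T.
Proof.
rewrite /= /ext_structure tr_col_mx trmx1 linearZ /= trmxK.
rewrite mul_col_mx mul_col_row mul1mx !mulmx1.
by rewrite -!scalemxAr -!scalemxAl scalerA expr2.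
Qed.

(** Energy balance: the rate of [H] along a solution is the quadratic form of
    [S] at some vector, namely [P^T grad H]. *)
Lemma ext_energy_rate M S V (eta : R -> R) (I : set R) (z : R -> 'cV[R]_d) t :
    ext_solution M S V eta I z -> I t ->
  exists u : 'cV[R]_d, is_derive t (1 : R)
    (fun s => ext_energy M (lift_state V (z s))) (quad_form S u).
Proof.
move=> sol It; have := sol t It.
rewrite ext_structure_congr; set P := col_mx _ _; set h := grad _ _ => Dz.
exists (P^T *m h).
have := is_derive_comp_grad _ _ _ _ Dz (differentiable_ext_energy M _).
by rewrite /quad_form trmx_mul trmxK -/h !mulmxA.
Qed.

End ExtendedSystem.

Theorem proposition3 (R : realType) (d : nat) (M S : 'M[R]_d)
    (V : 'cV[R]_d -> R) (eta : R -> R) (I : set R) (z : R -> 'cV[R]_d)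
    (M_posdef : sym_posdef M)
    (S_cases : S^T = - S \/ preceq0 S)
    (V_diff : forall x : 'cV[R]_d, differentiable V x)
    (I_open : open I) (I_itv : is_interval I)
    (z_sol : ext_solution M S V eta I z) :
  let energy := fun t : R => ext_energy M (lift_state V (z t)) in
  (S^T = - S ->
    forall t, I t -> derivable energy t 1 /\ 'D_1 energy t = 0) /\
  (preceq0 S ->
    forall t, I t -> derivable energy t 1 /\ 'D_1 energy t <= 0).
Proof.
move=> energy; split=> hS t It.
- have [u [energy_ex ->]] := ext_energy_rate _ _ _ _ _ _ _ z_sol It.
  by split=> //; exact: quad_form_skew.
- have [u [energy_ex ->]] := ext_energy_rate _ _ _ _ _ _ _ z_sol It.
  by split=> //; exact: quad_form_preceq0.
Qed.
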